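(* Let $\mathbf{k}$ be a field and $f(x)=x^N+u_{N-1}x^{N-1}+\dots+u_0\in\mathbf{k}[x]$ a separable polynomial irreducible over $\mathbf{k}$, with splitting field $K$ over $\mathbf{k}$ and roots $\alpha_1,\dots,\alpha_N\in K$. Let $R=\mathbb{Z}[x_1,\dots,x_N]^{S_N}=\mathbb{Z}[E_1,\dots,E_N]$ and let $\phi:R\to\mathbf{k}$ be the ring homomorphism $\phi(E_i)=(-1)^iu_{N-i}$. Suppose that $\mathrm{Gal}(K/\mathbf{k})=S_N$. Then for each sequence $\underline{a}=(a_1,\dots,a_k)$ of positive integers with $a_1+\dots+a_k=N$ there is a ring isomorphism $$\langle\Gamma_{\underline a}\rangle_\phi\;\cong\;K^{S_{\underline a}}$$ between the $\phi$-state space $\langle\Gamma_{\underline a}\rangle_\phi=\mathbb{Z}[x_1,\dots,x_N]^{S_{\underline a}}\otimes_R\mathbf{k}$ of the web $\Gamma_{\underline a}$ and the intermediate subfield $K^{S_{\underline a}}$ of $K/\mathbf{k}$.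
   Context: $E_k$ denotes the $k$-th elementary symmetric polynomial in $x_1,\dots,x_N$. $S_{\underline a}=S_{a_1}\times\dots\times S_{a_k}\subset S_N$ is the parabolic subgroup permuting separately the first $a_1$ indices, the next $a_2$ indices, etc.; via the identification $\mathrm{Gal}(K/\mathbf{k})=S_N$ (permutations of the roots $\alpha_1,\dots,\alpha_N$) it acts on $K$, and $K^{S_{\underline a}}$ is its fixed field. $\Gamma_{\underline a}$ is the generalized theta-web in $GL(N)$ foam theory in which lines of thickness $a_1,\dots,a_k$ merge into a line of thickness $N$ that goes around and splits back into these lines; its state space is the $R$-algebra $\langle\Gamma_{\underline a}\rangle\cong\mathbb{Z}[x_1,\dots,x_N]^{S_{\underline a}}$, and its base-changed state space is $\langle\Gamma_{\underline a}\rangle_\phi:=\langle\Gamma_{\underline a}\rangle\otimes_R\mathbf{k}$, with $\mathbf{k}$ an $R$-algebra via $\phi$. *)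

(* Defs.v *)
From HB Require Import structures.
From mathcomp Require Import all_boot all_order all_fingroup all_algebra all_field.
From mathcomp Require Import boolp.
From mathcomp Require Import mpoly.

Set Implicit Arguments.
Unset Strict Implicit.
Unset Printing Implicit Defensive.

Import GRing.Theory.

Local Open Scope ring_scope.
Local Open Scope quotient_scope.

Local Notation repr := generic_quotient.repr.

Section TensorProduct.
Variables (R A B : comPzRingType).
Variables (f : {rmorphism R -> A}) (g : {rmorphism R -> B}).

(* The list [:: (a1, b1); ...; (an, bn)] stands for a1 (x) b1 + ... + an (x) bn.
   tensor_eq is the least additive congruence on such formal sums that makes
   (x) commutative-monoid valued, biadditive and R-balanced.  The rule
   tensor_eq_0l is not redundant: before it is imposed the quotient is only
   a monoid, in which 0 (x) b is merely idempotent. *)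
Inductive tensor_eq : seq (A * B) -> seq (A * B) -> Prop :=
| tensor_eq_refl s : tensor_eq s s
| tensor_eq_sym s t : tensor_eq s t -> tensor_eq t s
| tensor_eq_trans s t u : tensor_eq s t -> tensor_eq t u -> tensor_eq s u
| tensor_eq_cat s s' t t' :
    tensor_eq s s' -> tensor_eq t t' -> tensor_eq (s ++ t) (s' ++ t')
| tensor_eq_catC s t : tensor_eq (s ++ t) (t ++ s)
| tensor_eq_0l b : tensor_eq [:: (0, b)] [::]
| tensor_eq_Dl a a' b :
    tensor_eq [:: (a + a', b)] [:: (a, b); (a', b)]
| tensor_eq_Dr a b b' :
    tensor_eq [:: (a, b + b')] [:: (a, b); (a, b')]
| tensor_eq_scale r a b :
    tensor_eq [:: (f r * a, b)] [:: (a, g r * b)].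

Definition tensor_eqb (s t : seq (A * B)) : bool := `[< tensor_eq s t >].

Fact tensor_eqb_refl : reflexive tensor_eqb.
Proof. by move=> s; apply/asboolP; exact: tensor_eq_refl. Qed.

Fact tensor_eqb_sym s t : tensor_eqb s t = tensor_eqb t s.
Proof.
by apply/asboolP/asboolP => /tensor_eq_sym.
Qed.

Fact tensor_eqb_trans : transitive tensor_eqb.
Proof.
move=> t s u /asboolP st /asboolP tu; apply/asboolP.
exact: tensor_eq_trans st tu.
Qed.

Canonical tensor_equiv :=
  EquivRel tensor_eqb tensor_eqb_refl tensor_eqb_sym tensor_eqb_trans.

Definition tensor := {eq_quot tensor_equiv}.
HB.instance Definition _ := Choice.on tensor.
HB.instance Definition _ := EqQuotient.on tensor.

Definition tensor_class (s : seq (A * B)) : tensor := \pi_tensor s.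

Lemma tensor_classP s t : tensor_class s = tensor_class t <-> tensor_eq s t.
Proof.
split; last by move=> st; apply/eqmodP/asboolP.
by move=> /eqmodP /asboolP.
Qed.

Lemma tensor_class_repr (x : tensor) : tensor_class (repr x) = x.
Proof. exact: reprK. Qed.

Lemma tensor_eq_perm s t : perm_eq s t -> tensor_eq s t.
Proof.
elim: s t => [|x s IH] t st.
  by move: st; rewrite perm_sym => /perm_nilP ->; exact: tensor_eq_refl.
have xt : x \in t by rewrite -(perm_mem st) mem_head.
case/splitPr: xt st => t1 t2.
rewrite perm_sym -[x :: t2]cat1s perm_catCA perm_cons perm_sym => st.
apply: (@tensor_eq_trans _ ([:: x] ++ (t1 ++ t2))).
  by apply: (tensor_eq_cat (tensor_eq_refl [:: x])); exact: IH.
rewrite !catA; apply: tensor_eq_cat (tensor_eq_refl _).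
exact: tensor_eq_catC.
Qed.

Definition pair_mul (x y : A * B) : A * B := (x.1 * y.1, x.2 * y.2).

Definition formal_mul (s t : seq (A * B)) : seq (A * B) :=
  [seq pair_mul x y | x <- s, y <- t].

Definition formal_opp (s : seq (A * B)) : seq (A * B) :=
  [seq (- x.1, x.2) | x <- s].

Lemma formal_mul1l x t : formal_mul [:: x] t = [seq pair_mul x y | y <- t].
Proof. by rewrite /formal_mul /= cats0. Qed.

Lemma formal_mulDl s s' t :
  formal_mul (s ++ s') t = formal_mul s t ++ formal_mul s' t.
Proof. exact: allpairs_cat. Qed.

Lemma formal_mulC s t : tensor_eq (formal_mul s t) (formal_mul t s).
Proof.
apply: tensor_eq_perm; elim: s t => [|x s IH] t.
  by rewrite /formal_mul allpairs0r.
have -> : formal_mul (x :: s) t = [seq pair_mul y x | y <- t] ++ formal_mul s t.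
  rewrite -cat1s formal_mulDl formal_mul1l; congr (_ ++ _).
  by apply: eq_map => y; rewrite /pair_mul [x.1 * _]mulrC [x.2 * _]mulrC.
have /permPl/perm_trans := perm_allpairs_consr pair_mul t (fun=> x) (fun=> s).
rewrite perm_sym; apply; rewrite perm_sym.
by apply: perm_cat (perm_refl _) _; exact: IH.
Qed.

Lemma formal_mul_eql s s' t :
  tensor_eq s s' -> tensor_eq (formal_mul s t) (formal_mul s' t).
Proof.
move=> ss'; elim: {s s'}ss' t => [s|s s' _ IH|s s' u _ IH1 _ IH2|
   s s' u u' _ IH1 _ IH2|s s'|b|a a' b|a b b'|r a b] t.
- exact: tensor_eq_refl.
- exact: tensor_eq_sym.
- exact: tensor_eq_trans (IH1 t) (IH2 t).
- by rewrite !formal_mulDl; exact: tensor_eq_cat.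
- by rewrite !formal_mulDl; exact: tensor_eq_catC.
- rewrite formal_mul1l /=; elim: t => [|y t IH] /=; first exact: tensor_eq_refl.
  apply: (@tensor_eq_cat [:: _] [::] _ [::]) IH.
  by rewrite /pair_mul mul0r; exact: tensor_eq_0l.
- rewrite (formal_mulDl [:: _] [:: _]) !formal_mul1l.
  elim: t => [|y t IH] /=; first exact: tensor_eq_refl.
  apply: (@tensor_eq_trans _ ([:: pair_mul (a, b) y; pair_mul (a', b) y] ++
    ([seq pair_mul (a, b) y | y <- t] ++ [seq pair_mul (a', b) y | y <- t]))).
    apply: (@tensor_eq_cat [:: _] [:: _; _]) IH.
    by rewrite /pair_mul /= mulrDl; exact: tensor_eq_Dl.
  by apply: tensor_eq_perm => /=; rewrite perm_cons -cat1s perm_catCA.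
- rewrite (formal_mulDl [:: _] [:: _]) !formal_mul1l.
  elim: t => [|y t IH] /=; first exact: tensor_eq_refl.
  apply: (@tensor_eq_trans _ ([:: pair_mul (a, b) y; pair_mul (a, b') y] ++
    ([seq pair_mul (a, b) y | y <- t] ++ [seq pair_mul (a, b') y | y <- t]))).
    apply: (@tensor_eq_cat [:: _] [:: _; _]) IH.
    by rewrite /pair_mul /= mulrDl; exact: tensor_eq_Dr.
  by apply: tensor_eq_perm => /=; rewrite perm_cons -cat1s perm_catCA.
- rewrite !formal_mul1l.
  elim: t => [|y t IH] /=; first exact: tensor_eq_refl.
  apply: (@tensor_eq_cat [:: _] [:: _]) IH.
  by rewrite /pair_mul /= -!mulrA; exact: tensor_eq_scale.
Qed.

Lemma formal_mul_eq s s' t t' : tensor_eq s s' -> tensor_eq t t' ->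
  tensor_eq (formal_mul s t) (formal_mul s' t').
Proof.
move=> ss' tt'; apply: tensor_eq_trans (formal_mul_eql t ss') _.
apply: tensor_eq_trans (formal_mulC _ _) _.
apply: tensor_eq_trans (formal_mulC _ _).
exact: formal_mul_eql.
Qed.

Lemma formal_oppK s : tensor_eq (formal_opp s ++ s) [::].
Proof.
elim: s => [|[a b] s IH] /=; first exact: tensor_eq_refl.
apply: (@tensor_eq_trans _ ([:: (- a, b); (a, b)] ++ (formal_opp s ++ s))).
  by apply: tensor_eq_perm => /=; rewrite perm_cons -cat1s perm_catCA.
apply: (@tensor_eq_cat [:: _; _] [::] _ [::]) IH.
apply: tensor_eq_trans (tensor_eq_sym (tensor_eq_Dl _ _ _)) _.
by rewrite addNr; exact: tensor_eq_0l.
Qed.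

Definition tensor_zero : tensor := tensor_class [::].
Definition tensor_one : tensor := tensor_class [:: (1, 1)].
Definition tensor_add (x y : tensor) : tensor :=
  tensor_class (repr x ++ repr y).
Definition tensor_opp (x : tensor) : tensor :=
  tensor_class (formal_opp (repr x)).
Definition tensor_mul (x y : tensor) : tensor :=
  tensor_class (formal_mul (repr x) (repr y)).

Lemma repr_class s : tensor_eq (repr (tensor_class s)) s.
Proof. by apply/tensor_classP; rewrite tensor_class_repr. Qed.

Lemma tensor_addE s t :
  tensor_add (tensor_class s) (tensor_class t) = tensor_class (s ++ t).
Proof. by apply/tensor_classP; apply: tensor_eq_cat; exact: repr_class. Qed.

Lemma tensor_mulE s t :
  tensor_mul (tensor_class s) (tensor_class t) = tensor_class (formal_mul s t).
Proof. by apply/tensor_classP; apply: formal_mul_eq; exact: repr_class. Qed.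

Lemma tensor_ind (P : tensor -> Prop) :
  (forall s, P (tensor_class s)) -> forall x, P x.
Proof. by move=> Ps x; rewrite -(tensor_class_repr x). Qed.

Fact tensor_addA : associative tensor_add.
Proof.
elim/tensor_ind=> s; elim/tensor_ind=> t; elim/tensor_ind=> u.
by rewrite !tensor_addE catA.
Qed.

Fact tensor_addC : commutative tensor_add.
Proof.
elim/tensor_ind=> s; elim/tensor_ind=> t; rewrite !tensor_addE.
by apply/tensor_classP; exact: tensor_eq_catC.
Qed.

Fact tensor_add0 : left_id tensor_zero tensor_add.
Proof. by elim/tensor_ind=> s; rewrite tensor_addE. Qed.

Fact tensor_addN : left_inverse tensor_zero tensor_opp tensor_add.
Proof.
move=> x; rewrite -{2}(tensor_class_repr x) tensor_addE.
by apply/tensor_classP; exact: formal_oppK.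
Qed.

HB.instance Definition _ := GRing.isZmodule.Build tensor
  tensor_addA tensor_addC tensor_add0 tensor_addN.

Fact tensor_mulC : commutative tensor_mul.
Proof.
elim/tensor_ind=> s; elim/tensor_ind=> t; rewrite !tensor_mulE.
by apply/tensor_classP; exact: formal_mulC.
Qed.

Fact tensor_mulA : associative tensor_mul.
Proof.
elim/tensor_ind=> s; elim/tensor_ind=> t; elim/tensor_ind=> u.
rewrite !tensor_mulE; congr tensor_class.
elim: s => // x s IH.
have consE r : formal_mul (x :: s) r = map (pair_mul x) r ++ formal_mul s r.
  exact: allpairs_cons.
rewrite !consE formal_mulDl IH; congr (_ ++ _).
rewrite /formal_mul map_allpairs allpairs_mapl.
by apply: eq_allpairs => y z; rewrite /pair_mul /= !mulrA.
Qed.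

Fact tensor_mul1 : left_id tensor_one tensor_mul.
Proof.
elim/tensor_ind=> s; rewrite tensor_mulE formal_mul1l; congr tensor_class.
rewrite -[RHS]map_id; apply: eq_map => -[a b].
by rewrite /pair_mul !mul1r.
Qed.

Fact tensor_mulD : left_distributive tensor_mul tensor_add.
Proof.
elim/tensor_ind=> s; elim/tensor_ind=> t; elim/tensor_ind=> u.
by rewrite tensor_addE !tensor_mulE tensor_addE formal_mulDl.
Qed.

HB.instance Definition _ := GRing.Zmodule_isComPzRing.Build tensor
  tensor_mulA tensor_mulC tensor_mul1 tensor_mulD.

End TensorProduct.

Section Invariants.
Variables (N : nat) (H : {set 'S_N}).

Definition invariant_pred : pred {mpoly int[N]} :=
  fun p => [forall s in H, msym s p == p].

Lemma invariantP p :
  reflect (forall s, s \in H -> msym s p = p) (p \in invariant_pred).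
Proof.
by apply: (iffP forall_inP) => pH s sH; apply/eqP; [exact: pH | rewrite pH].
Qed.

Fact invariant_subring : subring_closed invariant_pred.
Proof.
split=> [|p q /invariantP pH /invariantP qH|p q /invariantP pH /invariantP qH];
  apply/invariantP => s sH.
- exact: msym1.
- by rewrite msymB pH ?qH.
- by rewrite msymM pH ?qH.
Qed.

HB.instance Definition _ :=
  GRing.isSubringClosed.Build {mpoly int[N]} invariant_pred invariant_subring.

Record invring := InvRing {
  invring_val :> {mpoly int[N]};
  _ : invring_val \in invariant_pred }.

HB.instance Definition _ := [isSub for invring_val].
HB.instance Definition _ := [Choice of invring by <:].
HB.instance Definition _ := [SubChoice_isSubComNzRing of invring by <:].

End Invariants.

Notation symring N := (invring [set: 'S_N]).

Fact mesym_invariant N (i : nat) :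
  mesym N int i \in invariant_pred [set: 'S_N].
Proof. by apply/invariantP => s _; apply/issymP/mesym_sym. Qed.

Definition elemsym N (i : nat) : symring N := InvRing (mesym_invariant N i).

Fact symring_invariant N (H : {set 'S_N}) (p : symring N) :
  invring_val p \in invariant_pred H.
Proof.
have /invariantP pS : val p \in invariant_pred [set: 'S_N] := valP p.
by apply/invariantP => s _; apply: pS; rewrite inE.
Qed.

Definition symring_incl N (H : {set 'S_N}) (p : symring N) : invring H :=
  InvRing (symring_invariant H p).

Fact symring_incl_zmod N (H : {set 'S_N}) : zmod_morphism (@symring_incl N H).
Proof. by move=> p q; apply: val_inj. Qed.

Fact symring_incl_monoid N (H : {set 'S_N}) :
  monoid_morphism (@symring_incl N H).
Proof. by split=> [|p q]; apply: val_inj. Qed.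

HB.instance Definition _ N (H : {set 'S_N}) :=
  GRing.isZmodMorphism.Build (symring N) (invring H) (@symring_incl N H)
    (@symring_incl_zmod N H).
HB.instance Definition _ N (H : {set 'S_N}) :=
  GRing.isMonoidMorphism.Build (symring N) (invring H) (@symring_incl N H)
    (@symring_incl_monoid N H).

(* reshape_index a i is the index of the block containing i when 0, 1, 2, ...
   is cut into consecutive blocks of lengths a1, ..., ak. *)
Definition young N (a : seq nat) : {set 'S_N} :=
  [set s : 'S_N | [forall i, reshape_index a (s i) == reshape_index a i]].

(* The web Gamma_a enters only through its state space, which is the R-algebra
   Z[x_1, ..., x_N]^(S_a) with R the ring of symmetric polynomials. *)
Definition theta_state_space N (a : seq nat) := invring (young N a).

Definition theta_state_space_at N (a : seq nat) (k : fieldType)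
    (phi : {rmorphism symring N -> k}) :=
  @tensor (symring N) (theta_state_space N a) k
    (@symring_incl N (young N a)) phi.

Section GaloisAction.
Variables (k : fieldType) (K : splittingFieldType k).
Variables (N : nat) (alpha : 'I_N -> K).

Definition permutes_roots (g : gal_of {:K}) (s : 'S_N) : bool :=
  [forall i, g (alpha i) == alpha (s i)].

Definition gal_of_perms (H : {set 'S_N}) : {set gal_of {:K}} :=
  [set g in 'Gal({:K} / 1)%g | [exists s in H, permutes_roots g s]].

End GaloisAction.

(* Main.v *)
Require Import Defs.
From HB Require Import structures.
From mathcomp Require Import all_boot all_order all_fingroup all_algebra all_field.
From mathcomp Require Import boolp mpoly.

Set Implicit Arguments.
Unset Strict Implicit.
Unset Printing Implicit Defensive.

Import GRing.Theory.
Local Open Scope ring_scope.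

(** The map from the tensor product to K sends p (x) b to p(alpha) b.

    Surjectivity is Galois theory: an automorphism fixing the coefficients of
    the polynomials prod_j (X - alpha_j), j ranging over a block, permutes the
    roots inside each block, so these coefficients generate K^(S_a).

    For injectivity, adjoin the variables one at a time.  Over the ring
    generated by the previous generators, x_i is a root of the monic polynomial
    prod_j (X - x_j), j >= i in the block of i, and has as many conjugates as
    its degree.  Hence Z[x] is free over Z[x]^(S_a), with 1 in a basis, and so
    Z[x]^(S_a) is an R-linear retract of Z[x]; this reduces the claim to
    Z[x] (x)_R k.  There the same tower with a single block, compared with the
    tower of the alpha_i over k, which is free because the Galois group is S_N,
    shows that Z[x] (x)_R k -> K is injective. *)

(** * Subrings given by [Prop]-valued predicates *)

Definition is_subring (S : pzRingType) (P : S -> Prop) : Prop :=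
  [/\ P 1, forall p q, P p -> P q -> P (p - q)
    & forall p q, P p -> P q -> P (p * q)].

Section Subring.
Variables (S : pzRingType) (P : S -> Prop).
Hypothesis subP : is_subring P.

Lemma is_subring0 : P 0.
Proof. by case: subP => P1 PB _; rewrite -(subrr 1); apply: PB. Qed.

Lemma is_subringD p q : P p -> P q -> P (p + q).
Proof.
case: subP => _ PB _ Pp Pq; rewrite -[q]opprK; apply: (PB) => //.
by rewrite -sub0r; apply: PB => //; apply: is_subring0.
Qed.

Lemma is_subring_sum I (r : seq I) (Q : pred I) F :
  (forall i, Q i -> P (F i)) -> P (\sum_(i <- r | Q i) F i).
Proof.
by move=> PF; apply: big_ind => //; [exact: is_subring0 | exact: is_subringD].
Qed.

Lemma is_subringX p m : P p -> P (p ^+ m).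
Proof.
case: subP => P1 _ PM Pp; elim: m => [|m IH]; first by rewrite expr0.
by rewrite exprS; apply: PM.
Qed.

Lemma is_subring_prod I (r : seq I) F :
  (forall i, P (F i)) -> P (\prod_(i <- r) F i).
Proof. by case: subP => P1 _ PM PF; apply: big_ind. Qed.

Lemma is_subring_int z : P z%:~R.
Proof.
case: subP => P1 PB _.
have Pn m : P m%:R.
  elim: m => [|m IH]; first exact: is_subring0.
  by rewrite -natr1; apply: is_subringD.
case: z => m; first exact: Pn.
by rewrite NegzE mulrNz -sub0r; apply: PB; [exact: is_subring0 | exact: Pn].
Qed.

End Subring.

(** * Towers of monic extensions *)

Section Tower.
Variables (S : comPzRingType) (x : nat -> S) (n : nat -> nat) (S0 : S -> Prop).

(* When the generators satisfy [monic_relation], [tower i] is the subring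
   S0[x_0, ..., x_(i-1)]. *)
Fixpoint tower (i : nat) : S -> Prop :=
  if i is j.+1 then fun p => exists2 c : nat -> S,
    forall d, tower j (c d) & p = \sum_(d < n j) c d * x j ^+ d
  else S0.

Definition monic_relation (i : nat) : Prop := exists2 c : nat -> S,
  forall d, tower i (c d) & x i ^+ n i = \sum_(d < n i) c d * x i ^+ d.

Variable i : nat.
Hypotheses (subi : is_subring (tower i)) (n_gt0 : (0 < n i)%N).

Lemma tower_incl p : tower i p -> tower i.+1 p.
Proof.
move=> ip; exists (fun d => if d == 0%N then p else 0).
  by move=> d; case: eqP => // _; exact: is_subring0 subi.
case: (n i) n_gt0 => // m _.
rewrite big_ord_recl /= mulr1 big1 ?addr0 // => j _.
by rewrite mul0r.
Qed.

Lemma tower_sub p q : tower i.+1 p -> tower i.+1 q -> tower i.+1 (p - q).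
Proof.
case=> c ic -> [c' ic' ->]; exists (fun d => c d - c' d).
  by case: subi => _ iB _ d; exact: iB (ic d) (ic' d).
by rewrite -sumrB; apply: eq_bigr => d _; rewrite mulrBl.
Qed.

Lemma tower_add p q : tower i.+1 p -> tower i.+1 q -> tower i.+1 (p + q).
Proof.
case=> c ic -> [c' ic' ->]; exists (fun d => c d + c' d).
  by move=> d; exact: is_subringD subi _ _ (ic d) (ic' d).
by rewrite -big_split; apply: eq_bigr => d _; rewrite mulrDl.
Qed.

Lemma tower_scale a p : tower i a -> tower i.+1 p -> tower i.+1 (a * p).
Proof.
case: subi => _ _ iM ia [c ic ->]; exists (fun d => a * c d).
  by move=> d; exact: iM ia (ic d).
by rewrite mulr_sumr; apply: eq_bigr => d _; rewrite mulrA.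
Qed.

Hypothesis rel : monic_relation i.

(** Multiplication by [x i] shifts the coefficients up by one. Only the top term leaves the allowed
    range of exponents, and the monic relation rewrites its power [x i ^+ n i]. *)
Lemma tower_mulx p : tower i.+1 p -> tower i.+1 (x i * p).
Proof.
case=> c ic ->; case: rel => r ir xr.
have -> : x i * (\sum_(d < n i) c d * x i ^+ d) =
    (\sum_(d < n i) (if d == 0%N :> nat then 0 else c d.-1) * x i ^+ d) +
    c (n i).-1 * x i ^+ n i.
  case: (n i) n_gt0 => // m _; rewrite mulr_sumr.
  rewrite [in RHS]big_ord_recl mul0r add0r big_ord_recr /=; congr (_ + _).
    by apply: eq_bigr => d _; rewrite mulrCA -exprS.
  by rewrite mulrCA -exprS.
apply: tower_add.
  exists (fun d => if d == 0%N then 0 else c d.-1) => //.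
  by case=> [|d]; [exact: is_subring0 subi | exact: ic].
by apply: tower_scale; [exact: ic | exists r].
Qed.

Lemma tower_gen : tower i.+1 (x i).
Proof.
rewrite -[x i]mulr1; apply: tower_mulx; apply: tower_incl.
by case: subi.
Qed.

Lemma tower_subring : is_subring (tower i.+1).
Proof.
split; first by case: subi => i1 _ _; apply: tower_incl.
  exact: tower_sub.
move=> p q [c ic ->] iq; rewrite mulr_suml.
apply: (@big_ind _ (tower i.+1)).
- exact: tower_incl (is_subring0 subi).
- exact: tower_add.
move=> d _; rewrite -mulrA; apply: tower_scale; first exact: ic.
elim: (d : nat) => [|m IH]; first by rewrite mul1r.
by rewrite exprS -mulrA; apply: tower_mulx.
Qed.

End Tower.

Lemma tower_map (S S' : comPzRingType) (h : {rmorphism S -> S'})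
    (x : nat -> S) (x' : nat -> S') n (S0 : S -> Prop) (S0' : S' -> Prop) i p :
  (forall a, S0 a -> S0' (h a)) -> (forall j, (j < i)%N -> h (x j) = x' j) ->
  tower x n S0 i p -> tower x' n S0' i (h p).
Proof.
move=> hS0; elim: i p => [|i IH] p hx /=; first exact: hS0.
case=> c ic ->; exists (h \o c).
  by move=> d; apply: IH => // j ji; apply: hx; apply: ltnW.
rewrite rmorph_sum; apply: eq_bigr => d _.
by rewrite rmorphM rmorphXn hx.
Qed.

Lemma monic_relation_map (S S' : comPzRingType) (h : {rmorphism S -> S'})
    (x : nat -> S) (x' : nat -> S') n (S0 : S -> Prop) (S0' : S' -> Prop) i :
  (forall a, S0 a -> S0' (h a)) -> (forall j, (j <= i)%N -> h (x j) = x' j) ->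
  monic_relation x n S0 i -> monic_relation x' n S0' i.
Proof.
move=> hS0 hx [c ic xi]; exists (h \o c).
  by move=> d; apply: (tower_map hS0) (ic d) => j /ltnW; exact: hx.
rewrite -hx // -rmorphXn xi rmorph_sum; apply: eq_bigr => d _.
by rewrite rmorphM rmorphXn.
Qed.

Lemma tower_fixed (S : comPzRingType) (h : {rmorphism S -> S}) x n
    (S0 : S -> Prop) i p :
  (forall a, S0 a -> h a = a) -> (forall j, (j < i)%N -> h (x j) = x j) ->
  tower x n S0 i p -> h p = p.
Proof.
move=> hS0; elim: i p => [|i IH] p hx /=; first exact: hS0.
case=> c ic ->; rewrite rmorph_sum; apply: eq_bigr => d _.
rewrite rmorphM rmorphXn hx // IH // => j ji.
by apply: hx; apply: ltnW.
Qed.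

(** * Freeness of the steps, and retractions onto the bottom ring *)

Definition step_free (S : comPzRingType) (x : nat -> S) n S0 i : Prop :=
  forall c : nat -> S, (forall d, tower x n S0 i (c d)) ->
    \sum_(d < n i) c d * x i ^+ d = 0 -> forall d, (d < n i)%N -> c d = 0.

(** A linear relation among the powers of [x i] is a polynomial of size at most [n i] vanishing at
    [x i]. Each [h] fixes its coefficients, so every conjugate in [rs] is a root as well; over a
    domain that is too many roots unless the polynomial is 0. *)
Lemma conjugates_step_free (S : idomainType) (x : nat -> S) n S0 i
    (rs : seq S) :
  uniq rs -> (n i <= size rs)%N ->
  (forall y : S, y \in rs -> exists h : {rmorphism S -> S},
     [/\ forall a, S0 a -> h a = a, forall j, (j < i)%N -> h (x j) = x j
       & h (x i) = y]) ->
  step_free x n S0 i.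
Proof.
move=> rs_uniq n_rs conj c ic c0 d dn.
pose P := \poly_(e < n i) c e.
have -> : c d = P`_d by rewrite coef_poly dn.
suff -> : P = 0 by rewrite coef0.
apply/eqP/negPn/negP => P0.
have rtP : all (root P) rs.
  apply/allP => y /conj[h [hS0 hx hxi]]; rewrite /root horner_poly.
  apply/eqP; transitivity (h (\sum_(d < n i) c d * x i ^+ d)).
    rewrite rmorph_sum; apply: eq_bigr => e _.
    by rewrite rmorphM rmorphXn hxi (tower_fixed hS0 hx (ic e)).
  by rewrite c0 rmorph0.
have := leq_trans (max_poly_roots P0 rtP rs_uniq) (size_poly _ _).
by rewrite ltnNge n_rs.
Qed.

(** [r] is a total function on [S], but the clauses constrain it only on [P] and [Q]. *)
Definition retraction_onto (S : pzRingType) (A P Q : S -> Prop) (r : S -> S) :=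
  [/\ forall p q, P p -> P q -> r (p + q) = r p + r q,
      forall a p, A a -> P p -> r (a * p) = a * r p,
      forall p, P p -> Q (r p) & forall p, Q p -> r p = p].

Section Retraction.
Variables (S : comNzRingType) (x : nat -> S) (n : nat -> nat) (S0 : S -> Prop).
Local Notation tower := (tower x n S0).

(** The retraction takes the coefficient of [x i ^+ 0]; freeness makes it independent of the chosen
    expansion. *)
Lemma step_retraction i : is_subring (tower i) -> (0 < n i)%N ->
  (forall a, S0 a -> tower i a) -> step_free x n S0 i ->
  exists r, retraction_onto S0 (tower i.+1) (tower i) r.
Proof.
move=> subi n_gt0 S0i freei.
(* Outside [tower i.+1] there is no expansion, and the value 0 is an arbitrary default. *)
have ex_r p : exists r, tower i.+1 p -> exists c : nat -> S,
    [/\ forall d, tower i (c d), p = \sum_(d < n i) c d * x i ^+ d & r = c 0%N].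
  case: (EM (tower i.+1 p)) => [[c ic ->]|np]; last by exists 0.
  by exists (c 0%N) => _; exists c.
case: (choice ex_r) => r rP; exists r.
have rE (c : nat -> S) p : (forall d, tower i (c d)) ->
    p = \sum_(d < n i) c d * x i ^+ d ->
    r p = c 0%N.
  move=> ic pE; have /rP[c' [ic' pE' ->]] : tower i.+1 p by exists c.
  apply/eqP; rewrite -subr_eq0; apply/eqP.
  apply: (freei (fun d => c' d - c d)) => //.
    by case: subi => _ iB _ d; exact: iB (ic' d) (ic d).
  by under eq_bigr do rewrite mulrBl; rewrite sumrB -pE -pE' subrr.
split.
- move=> p q [c ic pE] [c' ic' qE]; rewrite (rE c p) // (rE c' q) //.
  apply: (rE (fun d => c d + c' d)) => [d|].
    exact: is_subringD subi _ _ (ic d) (ic' d).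
  by rewrite pE qE -big_split; apply: eq_bigr => d _; rewrite mulrDl.
- move=> a p /S0i ia [c ic pE]; rewrite (rE c p) //.
  apply: (rE (fun d => a * c d)) => [d|].
    by case: subi => _ _ iM; exact: iM ia (ic d).
  by rewrite pE mulr_sumr; apply: eq_bigr => d _; rewrite mulrA.
- by move=> p [c ic pE]; rewrite (rE c p) //; exact: ic.
- move=> p ip; apply: (rE (fun d => if d == 0%N then p else 0)) => [d|].
    by case: eqP => // _; exact: is_subring0 subi.
  case: (n i) n_gt0 => // m _.
  rewrite big_ord_recl /= mulr1 big1 ?addr0 // => j _.
  by rewrite mul0r.
Qed.

(** The retractions of the single steps compose from the top down, and each of them is linear over
    the bottom ring. *)
Lemma tower_retraction N :
  (forall i, (i < N)%N ->
     [/\ is_subring (tower i), (0 < n i)%N & step_free x n S0 i]) ->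
  exists r, retraction_onto S0 (tower N) S0 r.
Proof.
move=> stepN.
have S0i i : (i <= N)%N -> forall a, S0 a -> tower i a.
  elim: i => // i IH iN a S0a; have [subi n_gt0 _] := stepN _ iN.
  by apply: tower_incl => //; apply: IH => //; apply: ltnW.
elim: N stepN S0i => [|N IH] stepN S0i; first by exists id; split.
have [||r [rD rM rS rid]] := IH.
- by move=> i iN; apply/stepN/ltnW.
- by move=> i iN; apply/S0i/leqW.
have [subN n_gt0 freeN] := stepN N (leqnn _).
have [t [tD tM tS tid]] := step_retraction subN n_gt0 (S0i N (leqnSn N)) freeN.
exists (r \o t); split=> /=.
- by move=> p q Np Nq; rewrite tD // rD //; apply: tS.
- by move=> b p Sb Np; rewrite tM // rM //; apply: tS.
- by move=> p Np; apply/rS/tS.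
- by move=> p S0p; rewrite tid ?rid //; apply: S0i.
Qed.

End Retraction.

Lemma tower_subrings (S : comPzRingType) (x : nat -> S) n S0 i :
  is_subring S0 ->
  (forall j, (j < i)%N -> (0 < n j)%N /\ monic_relation x n S0 j) ->
  [/\ is_subring (tower x n S0 i), forall a, S0 a -> tower x n S0 i a
    & forall j, (j < i)%N -> tower x n S0 i (x j)].
Proof.
move=> sub0; elim: i => [|i IH] rel; first by split.
have [|subi S0i xi] := IH; first by move=> j ji; apply/rel/ltnW.
have [n_gt0 reli] := rel i (leqnn _).
split; first exact: tower_subring.
  by move=> a S0a; apply: tower_incl => //; apply: S0i.
move=> j; rewrite ltnS leq_eqVlt => /predU1P[->|ji]; first exact: tower_gen.
by apply: tower_incl => //; apply: xi.
Qed.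

(** Division by ['X - a%:P] computes the coefficients of [q] from the top down, each from the next
    one and a coefficient of the product; hence the induction on [size q - m]. *)
Lemma coef_quotient_subring (S : comNzRingType) (P : S -> Prop) a (q : {poly S}) :
  is_subring P -> P a -> (forall m, P ((('X - a%:P) * q)`_m)) ->
  forall m, P q`_m.
Proof.
move=> subP Pa Pq m; have [d] := ubnP (size q - m); elim: d m => // d IH m.
rewrite ltnS => qm; have [/(nth_default 0) ->|mq] := leqP (size q) m.
  exact: is_subring0 subP.
have -> : q`_m = (('X - a%:P) * q)`_m.+1 + a * q`_m.+1.
  by rewrite mulrBl coefB coefXM coefCM /= subrK.
apply: is_subringD => //; case: subP => _ _ PM; apply: PM => //; apply: IH.
by rewrite subnS prednK ?subn_gt0.
Qed.

(** * Index blocks, and the monic relations that their polynomials give *)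

Section Blocks.
Variables (N : nat) (beta : nat -> nat).

(** [beta] labels the blocks: it will be [reshape_index a] for S_a, and constant for S_N. Only
    indices from [i] on are kept, because stage [i] of the tower already contains the earlier
    generators. *)
Definition block (i l : nat) : seq nat :=
  [seq j <- iota i (N - i) | beta j == beta l].

Definition block_size (i : nat) : nat := size (block i i).

Lemma mem_block i l j :
  (j \in block i l) = [&& (i <= j)%N, (j < N)%N & beta j == beta l].
Proof.
rewrite mem_filter mem_iota andbC -andbA.
have [ij|//] := leqP i j; rewrite /=; congr (_ && _).
have [iN|Ni] := leqP i N; first by rewrite subnKC.
(* [N <= i] unfolds to [N - i == 0], so the interval is empty. *)
rewrite (eqP (ltnW Ni)) addn0 ltnNge ij ltnNge.
by rewrite (leq_trans (ltnW Ni)).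
Qed.

Lemma block_recl i l : (i < N)%N ->
  block i l = if beta i == beta l then i :: block i.+1 l else block i.+1 l.
Proof. by move=> iN; rewrite /block -(subnSK iN). Qed.

Lemma block_size_gt0 i : (i < N)%N -> (0 < block_size i)%N.
Proof. by move=> iN; rewrite /block_size block_recl // eqxx. Qed.

(** What remains of the polynomial of the block of [l] once the roots of index below [i] are divided
    out. For [l = i] it yields the monic relation of [x i]. *)
Definition block_poly (S : nzRingType) (x : nat -> S) (i l : nat) : {poly S} :=
  \prod_(j <- block i l) ('X - (x j)%:P).

Section BlockTower.
Variables (S : comNzRingType) (x : nat -> S) (S0 : S -> Prop).
Local Notation tower := (tower x block_size S0).

Lemma block_monic_relation i : (i < N)%N -> is_subring (tower i) ->
  (forall m, tower i (block_poly x i i)`_m) ->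
  monic_relation x block_size S0 i.
Proof.
move=> iN subi coefi; exists (fun d => - (block_poly x i i)`_d).
  move=> d; case: (subi) => _ iB _; rewrite -sub0r; apply: iB => //.
  exact: is_subring0 subi.
have szP : size (block_poly x i i) = (block_size i).+1 by rewrite size_prod_XsubC.
have : (block_poly x i i).[x i] = 0.
  by rewrite /block_poly block_recl // eqxx big_cons hornerM hornerXsubC subrr mul0r.
have := monic_prod_XsubC (block i i) predT x.
rewrite -/(block_poly x i i) monicE lead_coefE szP => /eqP /= lc.
rewrite horner_coef szP big_ord_recr /= lc mul1r => /eqP.
rewrite addrC addr_eq0 => /eqP ->.
by rewrite -sumrN; apply: eq_bigr => d _; rewrite mulNr.
Qed.

(** The induction carries the relations below [i] together with the fact that all remaining block
    polynomials have coefficients in stage [i]. Passing to [i.+1] divides ['X - (x i)%:P] out of the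
    polynomial of one block and leaves the others unchanged. *)
Lemma block_tower : is_subring S0 -> (forall l m, S0 (block_poly x 0 l)`_m) ->
  forall i, (i < N)%N -> (0 < block_size i)%N /\ monic_relation x block_size S0 i.
Proof.
move=> sub0 coef0 i iN.
suff [rel coefi] : (forall j, (j < i)%N ->
    (0 < block_size j)%N /\ monic_relation x block_size S0 j) /\
    forall l m, tower i (block_poly x i l)`_m.
  split; first exact: block_size_gt0.
  by have [subi _ _] := tower_subrings sub0 rel; apply: block_monic_relation.
elim: i iN => [|i IH] iN; first by split.
have {IH} [rel coefi] := IH (ltnW iN).
have rel' j : (j < i.+1)%N ->
    (0 < block_size j)%N /\ monic_relation x block_size S0 j.
  rewrite ltnS leq_eqVlt => /predU1P[->|]; last exact: rel.
  split; first by apply/block_size_gt0/ltnW.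
  have [subi _ _] := tower_subrings sub0 rel.
  by apply: block_monic_relation => //; exact: ltnW.
split=> // l m.
have [subi _ _] := tower_subrings sub0 rel.
have [subi1 _ xi1] := tower_subrings sub0 rel'.
have [n_gt0 _] := rel' i (leqnn _).
have := coefi l; rewrite /block_poly block_recl; last exact: ltnW.
case: eqP => [_|_] coefil; last exact: tower_incl.
rewrite big_cons in coefil.
apply: (coef_quotient_subring subi1 (xi1 i (leqnn _))) => k.
exact: tower_incl.
Qed.

End BlockTower.
End Blocks.

(** * Block-preserving permutations and their action on polynomials *)

Definition block_perms (N : nat) (beta : nat -> nat) : {set 'S_N} :=
  [set s : 'S_N | [forall i, beta (s i) == beta i]].

Lemma block_permsP N (beta : nat -> nat) (s : 'S_N) :
  reflect (forall i, beta (s i) = beta i) (s \in block_perms N beta).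
Proof. by rewrite inE; apply: (iffP forallP) => H i; apply/eqP/H. Qed.

Lemma youngE N a : young N a = block_perms N (reshape_index a).
Proof. by []. Qed.

Lemma block_perms_const N : block_perms N (fun=> 0%N) = [set: 'S_N].
Proof. by apply/setP => s; rewrite !inE; apply/forallP => i. Qed.

Lemma msymXU N (R : nzRingType) (s : 'S_N) i :
  msym s 'X_i = 'X_(s i) :> {mpoly R[N]}.
Proof.
rewrite msymX; congr 'X_[_]; apply/mnmP => j.
by rewrite mnmE !mnm1E -(inj_eq (@perm_inj _ s)) permKV.
Qed.

(** Integer coefficients lie in every subring, so the variables generate everything. This serves as
    an induction principle for polynomials. *)
Lemma subring_mpoly N (P : {mpoly int[N]} -> Prop) :
  is_subring P -> (forall i, P 'X_i) -> forall p, P p.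
Proof.
move=> subP PX p; rewrite [p]mpolyE; apply: is_subring_sum => // m _.
case: (subP) => _ _ PM; rewrite -mul_mpolyC; apply: PM.
  have -> : (p@_m)%:MP = (p@_m)%:~R :> {mpoly int[N]}.
    by rewrite -[in LHS](intz p@_m) rmorph_int.
  exact: is_subring_int.
rewrite mpolyXE_id; apply: is_subring_prod => // i.
exact: is_subringX.
Qed.

Lemma invariant_is_subring N (H : {set 'S_N}) :
  is_subring (fun p : {mpoly int[N]} => p \in invariant_pred H).
Proof. by have [? ? ?] := invariant_subring H; split. Qed.

(** * Z[x] as a free tower over its invariants *)

Section MpolyTower.
Variables (M : nat) (beta : nat -> nat).
Local Notation N := M.+1.
Local Notation H := (block_perms N beta).
Local Notation n := (block_size N beta).

(** Towers are indexed by natural numbers; [inord] converts these to variables and requires the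
    number of variables to be a successor. *)
Definition mvar (j : nat) : {mpoly int[N]} := 'X_(inord j).
Definition block_inv (p : {mpoly int[N]}) : Prop := p \in invariant_pred H.

Lemma block_poly_ord (S : comNzRingType) (x : 'I_N -> S) l :
  block_poly N beta (x \o inord) 0 l =
  \prod_(j < N | beta j == beta l) ('X - (x j)%:P).
Proof.
rewrite /block_poly /block big_filter -/(index_iota 0 N) big_mkord.
by apply: eq_bigr => j _; rewrite /= inord_val.
Qed.

(** A block-preserving permutation only reorders the factors of a block polynomial. *)
Lemma block_poly_inv l m : block_inv (block_poly N beta mvar 0 l)`_m.
Proof.
apply/invariantP => s /block_permsP sH.
rewrite (block_poly_ord (fun i => 'X_i)) -coef_map; congr (polyseq _)`_m.
rewrite rmorph_prod /= [RHS](reindex_inj (@perm_inj _ s)) /=.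
apply: eq_big => j; first by rewrite sH.
by rewrite map_polyXsubC /= msymXU.
Qed.

Lemma mpoly_tower_relation i : (i < N)%N ->
  (0 < n i)%N /\ monic_relation mvar n block_inv i.
Proof.
apply: block_tower; first exact: invariant_is_subring.
exact: block_poly_inv.
Qed.

Lemma mpoly_tower_full p : tower mvar n block_inv N p.
Proof.
have [subN _ xN] := tower_subrings (invariant_is_subring H) mpoly_tower_relation.
apply: subring_mpoly => // i.
by have := xN i (ltn_ord i); rewrite /mvar inord_val.
Qed.

Lemma tperm_block_perms i j : beta (i : 'I_N) = beta (j : 'I_N) -> tperm i j \in H.
Proof. by move=> ij; apply/block_permsP => l; case: tpermP => // ->. Qed.

(** The conjugates of x_i are the x_j with [j >= i] in its block. The transposition of [i] and [j]
    realizes them: it preserves the blocks, so it fixes the invariants, and it moves no variable of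
    index below [i]. *)
Lemma mpoly_step_free i : (i < N)%N -> step_free mvar n block_inv i.
Proof.
move=> iN; have lt_block j : j \in block N beta i i -> (j < N)%N.
  by rewrite mem_block => /and3P[].
apply: (@conjugates_step_free _ _ _ _ _ [seq mvar j | j <- block N beta i i]).
- rewrite map_inj_in_uniq ?filter_uniq ?iota_uniq // => j l /lt_block jN /lt_block lN.
  move/(congr1 (mcoeff U_(inord j))); rewrite !mcoeffXU eqxx.
  case: eqP => [jl _|_ /eqP]; last by rewrite oner_eq0.
  by rewrite -(inordK jN) -(inordK lN) jl.
- by rewrite size_map.
move=> _ /mapP[j jb ->]; have jN := lt_block j jb.
move: jb; rewrite mem_block => /and3P[ij _ /eqP bji].
exists (msym (tperm (inord i : 'I_N) (inord j))); split.
- move=> p /invariantP; apply; apply: tperm_block_perms.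
  by rewrite !inordK.
- move=> l li; rewrite /mvar /= msymXU tpermD //; apply/eqP => /(congr1 val) /=.
    by rewrite !inordK ?(ltn_trans li) // => il; rewrite il ltnn in li.
  rewrite !inordK ?(ltn_trans li) // => jl.
  by rewrite jl leqNgt li in ij.
- by rewrite /mvar /= msymXU tpermL.
Qed.

Lemma mpoly_retraction : exists r : {mpoly int[N]} -> {mpoly int[N]},
  [/\ forall p q, r (p + q) = r p + r q,
      forall a p, a \in invariant_pred H -> r (a * p) = a * r p,
      forall p, r p \in invariant_pred H
    & forall p, p \in invariant_pred H -> r p = p].
Proof.
have [i iN|r [rD rM rS rid]] := @tower_retraction _ mvar n block_inv N.
  have [n_gt0 reli] := mpoly_tower_relation iN.
  have [|subi _ _] := @tower_subrings _ mvar n block_inv i (invariant_is_subring H).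
    by move=> j ji; apply: mpoly_tower_relation; apply: ltn_trans iN.
  by split=> //; apply: mpoly_step_free.
have full := mpoly_tower_full.
by exists r; split=> // *; [apply: rD | apply: rM | apply: rS].
Qed.

End MpolyTower.

(** If [h] kills an expansion in the source, freeness of the target tower forces [h] to kill each
    coefficient, and these lie one stage lower. So injectivity climbs from the bottom ring. *)
Lemma tower_injective (S S' : comPzRingType) (h : {rmorphism S -> S'})
    (x : nat -> S) (x' : nat -> S') n (S0 : S -> Prop) (S0' : S' -> Prop) i :
  (forall a, S0 a -> S0' (h a)) -> (forall j, (j < i)%N -> h (x j) = x' j) ->
  (forall j, (j < i)%N -> step_free x' n S0' j) ->
  (forall a, S0 a -> h a = 0 -> a = 0) ->
  forall p, tower x n S0 i p -> h p = 0 -> p = 0.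
Proof.
move=> hS0 hx free inj0.
elim: i hx free => [|i IH] hx free p //=; first exact: inj0.
case=> c ic ->; rewrite rmorph_sum => /= h0; rewrite big1 // => d _.
have hx' j : (j < i)%N -> h (x j) = x' j by move=> /ltnW; exact: hx.
suff -> : c d = 0 by rewrite mul0r.
apply: IH => //.
  by move=> j /ltnW; exact: free.
apply: (free i (leqnn _) (h \o c)) => //.
  by move=> e; apply: tower_map (hS0) hx' (ic e).
rewrite -[RHS]h0; apply: eq_bigr => e _.
by rewrite rmorphM rmorphXn hx.
Qed.

(** * Ring morphisms out of the tensor product *)

Section TensorLift.
Variables (R A B C : comPzRingType).
Variables (f : {rmorphism R -> A}) (g : {rmorphism R -> B}).
Variables (u : {rmorphism A -> C}) (v : {rmorphism B -> C}).
Hypothesis uv : forall r, u (f r) = v (g r).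

Definition formal_eval (s : seq (A * B)) : C := \sum_(x <- s) u x.1 * v x.2.

Lemma formal_eval_eq s t : tensor_eq f g s t -> formal_eval s = formal_eval t.
Proof.
rewrite /formal_eval; elim=> {s t} [||s t w _ IH1 _ IH2|
  s s' t t' _ IH1 _ IH2|s t|b|a a' b|a b b'|r a b] //.
- by rewrite IH1.
- by rewrite !big_cat IH1 IH2.
- by rewrite !big_cat /= addrC.
- by rewrite big_seq1 big_nil rmorph0 mul0r.
- by rewrite !big_cons !big_nil /= rmorphD mulrDl !addr0.
- by rewrite !big_cons !big_nil /= rmorphD mulrDr !addr0.
- by rewrite !big_seq1 !rmorphM uv mulrCA mulrA.
Qed.

Lemma formal_evalM s t : formal_eval (formal_mul s t) = formal_eval s * formal_eval t.
Proof.
rewrite /formal_eval /formal_mul big_allpairs_dep mulr_suml; apply: eq_bigr => x _.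
rewrite mulr_sumr; apply: eq_bigr => y _.
by rewrite /pair_mul /= !rmorphM mulrACA.
Qed.

(** The universal property: a chosen representative is evaluated, and [formal_eval_eq] makes the
    choice irrelevant. *)
Lemma tensor_lift : exists h : {rmorphism tensor f g -> C},
  forall s, h (tensor_class f g s) = formal_eval s.
Proof.
pose h (t : tensor f g) := formal_eval (generic_quotient.repr t).
have hE s : h (tensor_class f g s) = formal_eval s.
  by apply: formal_eval_eq; exact: Defs.repr_class.
have hD : {morph h : x y / x + y}.
  elim/tensor_ind=> s; elim/tensor_ind=> t.
  by rewrite [_ + _]tensor_addE !hE /formal_eval big_cat.
have hB : zmod_morphism h.
  by move=> x y; apply: (addIr (h y)); rewrite -hD !subrK.
have hM : monoid_morphism h.
  split.
    rewrite [1]/(tensor_class f g [:: (1, 1)]) hE /formal_eval big_seq1.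
    by rewrite !rmorph1 mulr1.
  elim/tensor_ind=> s; elim/tensor_ind=> t.
  by rewrite [_ * _]tensor_mulE !hE formal_evalM.
pose hz := GRing.isZmodMorphism.Build _ _ h hB.
pose hm := GRing.isMonoidMorphism.Build _ _ h hM.
pose H : {rmorphism tensor f g -> C} := HB.pack h hz hm.
by exists H.
Qed.

End TensorLift.

(** * The two factors inside the tensor product *)

Section TensorInl.
Variables (R A B : comPzRingType).
Variables (f : {rmorphism R -> A}) (g : {rmorphism R -> B}).

Definition tensor_inl (a : A) : tensor f g := tensor_class f g [:: (a, 1)].
Definition tensor_inr (b : B) : tensor f g := tensor_class f g [:: (1, b)].

Lemma tensor_inlD : {morph tensor_inl : a b / a + b}.
Proof.
move=> a b; rewrite [RHS]tensor_addE; apply/tensor_classP.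
exact: tensor_eq_Dl.
Qed.

Fact tensor_inl_zmod : zmod_morphism tensor_inl.
Proof. by move=> a b; apply: (addIr (tensor_inl b)); rewrite -tensor_inlD !subrK. Qed.

Fact tensor_inl_monoid : monoid_morphism tensor_inl.
Proof.
by split=> // a b; rewrite [RHS]tensor_mulE formal_mul1l /pair_mul /= mulr1.
Qed.

HB.instance Definition _ := GRing.isZmodMorphism.Build A (tensor f g) tensor_inl
  tensor_inl_zmod.
HB.instance Definition _ := GRing.isMonoidMorphism.Build A (tensor f g) tensor_inl
  tensor_inl_monoid.

Lemma tensor_inrD : {morph tensor_inr : a b / a + b}.
Proof.
move=> a b; rewrite [RHS]tensor_addE; apply/tensor_classP.
exact: tensor_eq_Dr.
Qed.

Lemma tensor_inrM : {morph tensor_inr : a b / a * b}.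
Proof.
by move=> a b; rewrite [RHS]tensor_mulE formal_mul1l /pair_mul /= mulr1.
Qed.

Lemma tensor_inrB : {morph tensor_inr : a b / a - b}.
Proof. by move=> a b; apply: (addIr (tensor_inr b)); rewrite -tensor_inrD !subrK. Qed.

Lemma tensor_inl_scale r : tensor_inl (f r) = tensor_inr (g r).
Proof.
apply/tensor_classP; have := tensor_eq_scale f g r 1 1.
by rewrite !mulr1.
Qed.

Lemma tensor_class_sum s :
  tensor_class f g s = \sum_(x <- s) tensor_inl x.1 * tensor_inr x.2.
Proof.
elim: s => [|[a b] s IH]; first by rewrite big_nil.
rewrite big_cons -IH [_ * _]tensor_mulE formal_mul1l /pair_mul /= mulr1 mul1r.
by rewrite [RHS]tensor_addE.
Qed.

Lemma tensor_inr_subring : is_subring (fun t => exists b, t = tensor_inr b).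
Proof.
split; first by exists 1.
  by move=> _ _ [a ->] [b ->]; exists (a - b); rewrite tensor_inrB.
by move=> _ _ [a ->] [b ->]; exists (a * b); rewrite tensor_inrM.
Qed.

End TensorInl.

(** Functoriality in the first factor for R-linear maps. It will be applied to a retraction, which
    need not be multiplicative, so it is phrased on formal sums and not as a ring morphism. *)
Lemma tensor_eq_map (R A A' B : comPzRingType) (f : {rmorphism R -> A})
    (f' : {rmorphism R -> A'}) (g : {rmorphism R -> B}) (rho : A -> A') :
  {morph rho : a b / a + b} -> (forall r a, rho (f r * a) = f' r * rho a) ->
  forall s t, tensor_eq f g s t ->
  tensor_eq f' g [seq (rho x.1, x.2) | x <- s] [seq (rho x.1, x.2) | x <- t].
Proof.
move=> rhoD rhoM.
have rho0 : rho 0 = 0 by apply: (addIr (rho 0)); rewrite -rhoD !add0r.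
move=> s t; elim=> {s t} [s|s t _|s t u _ IH1 _ IH2|
  s s' t t' _ IH1 _ IH2|s t|b|a a' b|a b b'|r a b].
- exact: tensor_eq_refl.
- exact: tensor_eq_sym.
- exact: tensor_eq_trans IH1 IH2.
- by rewrite !map_cat; exact: tensor_eq_cat.
- by rewrite !map_cat; exact: tensor_eq_catC.
- by rewrite /= rho0; exact: tensor_eq_0l.
- by rewrite /= rhoD; exact: tensor_eq_Dl.
- exact: tensor_eq_Dr.
- by rewrite /= rhoM; exact: tensor_eq_scale.
Qed.

(** * Evaluation of integer polynomials, and fields generated by a list *)

Definition eval_at (N : nat) (C : comNzRingType) (v : 'I_N -> C) :
  {rmorphism {mpoly int[N]} -> C} := mmap intr v.

Lemma eval_atX N (C : comNzRingType) (v : 'I_N -> C) i : eval_at v 'X_i = v i.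
Proof. by rewrite /eval_at /= mmapX mmap1U. Qed.

Lemma mpoly_rmorph_ext N (C : comNzRingType)
    (h1 h2 : {rmorphism {mpoly int[N]} -> C}) :
  (forall i, h1 'X_i = h2 'X_i) -> forall p, h1 p = h2 p.
Proof.
move=> hX; apply: subring_mpoly => //; split; first by rewrite !rmorph1.
  by move=> p q hp hq; rewrite !rmorphB hp hq.
by move=> p q hp hq; rewrite !rmorphM hp hq.
Qed.

(** In a finite extension the elements of the generated field are polynomials in the generators, so
    closure under ring operations suffices. *)
Lemma adjoin_seq_subring (k : fieldType) (K : splittingFieldType k)
    (P : K -> Prop) (rs : seq K) :
  is_subring P -> (forall b : k, P b%:A) -> (forall y, y \in rs -> P y) ->
  forall y, y \in <<1 & rs>>%VS -> P y.
Proof.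
move=> subP Pk; elim/last_ind: rs => [|rs z IH] Prs y.
  by rewrite adjoin_nil subfield_closed => /vlineP[b ->].
rewrite adjoin_rcons => /Fadjoin_polyP[p /polyOverP pE ->].
rewrite horner_coef; apply: is_subring_sum => // d _.
case: (subP) => _ _ PM; apply: PM.
  by apply: IH (pE d) => w wrs; apply: Prs; rewrite mem_rcons inE wrs orbT.
by apply: is_subringX => //; apply: Prs; rewrite mem_rcons mem_head.
Qed.

(** * Specialization of the variables to the roots of [f] *)

Section Specialization.
Variables (k : fieldType) (K : splittingFieldType k) (M : nat).
Local Notation N := M.+1.
Variables (f : {poly k}) (alpha : 'I_N -> K) (phi : {rmorphism symring N -> k}).
Hypothesis f_sep : separable_poly f.
Hypothesis K_split : splittingFieldFor 1%VS (map_poly (in_alg K) f) {:K}%VS.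
Hypothesis f_roots : map_poly (in_alg K) f = \prod_(i < N) ('X - (alpha i)%:P).
Hypothesis phi_E : forall i : nat, (1 <= i <= N)%N ->
  phi (elemsym N i) = (-1) ^+ i * f`_(N - i).
Hypothesis Gal_SN : forall s : 'S_N,
  exists2 g, g \in 'Gal({:K} / 1)%g & permutes_roots alpha g s.

Local Notation ev := (eval_at alpha).
Local Notation rootn := (alpha \o inord).
Local Notation scalar := (fun y : K => exists b : k, y = b%:A).

Lemma alpha_inj : injective alpha.
Proof.
have := f_sep; rewrite -(separable_map (in_alg K)) f_roots -big_enum.
rewrite -(big_map alpha predT (fun x => 'X - x%:P)) separable_prod_XsubC.
by move=> /= alpha_uniq; apply/injectiveP.
Qed.

Lemma ev_mesym i : ev (mesym N int i) = (mesym N K i).@[alpha].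
Proof.
rewrite /mesym !rmorph_sum; apply: eq_bigr => h _.
rewrite !rmorph_prod; apply: eq_bigr => j _.
by rewrite eval_atX /= mevalXU.
Qed.

(** By Vieta both sides equal the same coefficient of [f] up to sign, and the two signs cancel. *)
Lemma ev_elemsym i : (i < N)%N ->
  ev (mesym N int i.+1) = (phi (elemsym N i.+1))%:A.
Proof.
move=> iN; rewrite ev_mesym phi_E //.
have iN1 : (i.+1 < N.+1)%N by [].
have := mroots_coeff [tuple alpha j | j < N] (Ordinal iN1).
rewrite big_map big_enum -f_roots coef_map /=.
have -> : (mesym N K i.+1).@[tnth [tuple alpha j | j < N]] =
    (mesym N K i.+1).@[alpha].
  by apply: meval_eq => j; rewrite tnth_mktuple.
by move=> fE; rewrite -[RHS]in_algE rmorphM rmorph_sign /= fE signrMK.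
Qed.

(** By the fundamental theorem [r] is a polynomial in the elementary symmetric ones, where both ring
    morphisms agree. Since [phi] is defined only on [symring N], [liftE] provides each such
    polynomial as an element of that type. *)
Lemma ev_symmetric (r : symring N) : ev (val r) = (phi r)%:A.
Proof.
pose E := [tuple mesym N int i.+1 | i < N].
have liftE t : exists r : symring N, val r = t \mPo E /\ ev (val r) = (phi r)%:A.
  pose Q t := exists r : symring N, val r = t \mPo E /\ ev (val r) = (phi r)%:A.
  apply: (@subring_mpoly N Q _ _ t).
    split.
    - by exists 1; rewrite !rmorph1 scale1r.
    - move=> p q [r1 [r1E e1]] [r2 [r2E e2]]; exists (r1 - r2).
      have -> : val (r1 - r2) = val r1 - val r2 by [].
      split; first by rewrite r1E r2E rmorphB.
      by rewrite !rmorphB scalerBl -e1 -e2.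
    - move=> p q [r1 [r1E e1]] [r2 [r2E e2]]; exists (r1 * r2).
      have -> : val (r1 * r2) = val r1 * val r2 by [].
      split; first by rewrite r1E r2E rmorphM.
      by rewrite -[RHS]in_algE !rmorphM e1 e2.
  move=> i; exists (elemsym N i.+1); split; last exact: ev_elemsym.
  by rewrite comp_mpolyXU -tnth_nth tnth_mktuple.
have /sym_fundamental[t [tE _]] : val r \is symmetric.
  by apply/issymP => s; have /invariantP := valP r; apply; rewrite inE.
have [r' [r'E ev_r']] := liftE t.
by have /val_inj <- : val r' = val r by rewrite r'E.
Qed.

Local Notation n := (block_size N (fun=> 0%N)).

(** As the Galois group is all of S_N, some automorphism swaps the roots of indices [i] and [j] and
    fixes the others. So the roots of index at least [i] are conjugate over the earlier ones. *)
Lemma root_step_free i : (i < N)%N -> step_free rootn n scalar i.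
Proof.
move=> iN; have blockN j : j \in block N (fun=> 0%N) i i -> (i <= j < N)%N.
  by rewrite mem_block eqxx andbT.
apply: (@conjugates_step_free _ _ _ _ _ [seq rootn j | j <- block N (fun=> 0%N) i i]).
- rewrite map_inj_in_uniq ?filter_uniq ?iota_uniq // => j l.
  move=> /blockN/andP[_ jN] /blockN/andP[_ lN] /alpha_inj/(congr1 val) /=.
  by rewrite !inordK.
- by rewrite size_map.
move=> _ /mapP[j /blockN/andP[ij jN] ->].
have [g gG /forallP gs] := Gal_SN (tperm (inord i) (inord j)).
exists (g : {rmorphism K -> K}); split.
- by move=> _ [b ->]; apply: fixed_gal gG _; rewrite ?subvf ?rpredZ ?mem1v.
- move=> l li /=; rewrite (eqP (gs _)) tpermD //; apply/eqP => /(congr1 val) /=.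
    by rewrite !inordK ?(ltn_trans li) // => il; rewrite il ltnn in li.
  rewrite !inordK ?(ltn_trans li) // => jl.
  by rewrite jl leqNgt li in ij.
- by rewrite /= (eqP (gs _)) tpermL.
Qed.

Lemma full_eval_injective
    (h : {rmorphism
       tensor (val : {rmorphism symring N -> {mpoly int[N]}}) phi -> K}) :
  (forall s, h (tensor_class _ _ s) = formal_eval ev (in_alg K) s) ->
  forall t, h t = 0 -> t = 0.
Proof.
move=> hE.
pose inl := tensor_inl (val : {rmorphism symring N -> {mpoly int[N]}}) phi.
pose inr := tensor_inr (val : {rmorphism symring N -> {mpoly int[N]}}) phi.
pose T0 t := exists b, t = inr b.
have h_inl a : h (inl a) = ev a.
  by rewrite hE /formal_eval big_seq1 /= scale1r mulr1.
have h_inr b : h (inr b) = b%:A.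
  by rewrite hE /formal_eval big_seq1 /= rmorph1 mul1r.
pose beta := fun _ : nat => 0%N.
(* With a single block the invariants are the symmetric polynomials, which become scalars in the
   tensor product. So the tower of Z[x] maps to a tower over the copy of [k]. *)
have inl0 a : block_inv beta a -> T0 (inl a).
  rewrite /block_inv block_perms_const => aS.
  exists (phi (InvRing aS)).
  exact: (tensor_inl_scale _ _ (InvRing aS)).
pose x := inl \o @mvar M.
have rel i : (i < N)%N -> (0 < n i)%N /\ monic_relation x n T0 i.
  move=> iN; have [n_gt0 reli] := mpoly_tower_relation beta iN.
  split=> //; exact: (monic_relation_map (h := tensor_inl _ _) inl0 _ reli).
have [subN T0N _] := tower_subrings (tensor_inr_subring _ _) rel.
have full t : tower x n T0 N t.
  elim/tensor_ind: t => s; rewrite tensor_class_sum.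
  apply: is_subring_sum => // -[a b] _; case: (subN) => _ _ TM; apply: TM => /=.
    exact: (tower_map (h := tensor_inl _ _) inl0 _ (mpoly_tower_full beta a)).
  by apply: T0N; exists b.
move=> t; apply: (tower_injective (x' := rootn) (S0' := scalar)) (full t).
- by move=> _ [b ->]; exists b.
- by move=> j _; rewrite /x /= h_inl eval_atX.
- exact: root_step_free.
move=> _ [b ->]; rewrite h_inr => /eqP.
rewrite scaler_eq0 oner_eq0 orbF => /eqP ->.
(* 1 (x) 0 = 0 (x) 1, by moving the scalar 0 of R across the tensor sign. *)
apply/tensor_classP; apply: tensor_eq_trans (tensor_eq_0l _ _ 1).
by have := tensor_eq_scale val phi 0 1 1; rewrite !rmorph0 !mul0r => /tensor_eq_sym.
Qed.

(** * The fixed field as the set of values at the roots *)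

Section FixedField.
Variable beta : nat -> nat.
Local Notation H := (block_perms N beta).

Lemma gal_ev_msym (g : gal_of {:K}) s p :
  permutes_roots alpha g s -> g (ev p) = ev (msym s p).
Proof.
move=> /forallP gs.
pose h1 : {rmorphism {mpoly int[N]} -> K} := (g : {rmorphism K -> K}) \o ev.
pose h2 : {rmorphism {mpoly int[N]} -> K} := ev \o msym s.
apply: (@mpoly_rmorph_ext N K h1 h2) => i.
by rewrite /h1 /h2 /= msymXU -/ev !eval_atX (eqP (gs i)).
Qed.

Lemma ev_invariant_fixed p :
  p \in invariant_pred H -> ev p \in fixedField (gal_of_perms alpha H).
Proof.
move=> /invariantP pH; apply/fixedFieldP; first exact: memvf.
move=> g; rewrite inE => /andP[_ /existsP[s /andP[sH gs]]].
by rewrite (gal_ev_msym _ gs) pH.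
Qed.

Lemma scalar_fixed (b : k) : b%:A \in fixedField (gal_of_perms alpha H).
Proof. by rewrite rpredZ ?mem1v. Qed.

(** Generators of the fixed field. A block polynomial occurs once for each index in its block, and
    its coefficients are padded with zeros up to degree [N]. *)
Definition block_coefs : seq K :=
  [seq (block_poly N beta rootn 0 l)`_m | l <- iota 0 N, m <- iota 0 N.+1].

Lemma block_poly_over (i : 'I_N) :
  block_poly N beta rootn 0 i \is a polyOver <<1 & block_coefs>>%VS.
Proof.
apply/polyOverP => m; have [mN|Nm] := ltnP m N.+1.
  apply: seqv_sub_adjoin; apply/allpairsP; exists (i : nat, m).
  by rewrite !mem_iota /= ltn_ord.
rewrite nth_default ?rpred0 //; apply: leq_trans Nm.
rewrite size_prod_XsubC ltnS size_filter (leq_trans (count_size _ _)) //.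
by rewrite size_iota.
Qed.

Lemma gal_block_coefs :
  'Gal({:K} / <<1 & block_coefs>>)%g \subset gal_of_perms alpha H.
Proof.
apply/subsetP => g gE.
have sub1E : (1 <= <<1 & block_coefs>>)%VS by exact: subv_adjoin_seq.
(* [g] fixes the polynomial of the block of [i], hence sends the root [alpha i] to a root in the
   same block. *)
have ex_j i : exists j : 'I_N, g (alpha i) = alpha j /\ beta j = beta i.
  pose P := block_poly N beta rootn 0 i.
  have PE : P = \prod_(a <- [seq rootn j | j <- block N beta 0 i]) ('X - a%:P).
    by rewrite big_map.
  have rP y : root P y = (y \in [seq rootn j | j <- block N beta 0 i]).
    by rewrite PE root_prod_XsubC.
  have gP : map_poly g P = P.
    apply/polyP => m; rewrite coef_map /=.
    exact: fixed_gal (subvf _) gE (polyOverP (block_poly_over i) m).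
  have : root P (g (alpha i)).
    rewrite -gP /root horner_map /=.
    suff /eqP -> : root P (alpha i) by rewrite rmorph0.
    rewrite rP; apply/mapP; exists (i : nat).
      by rewrite mem_block ltn_ord eqxx.
    by rewrite /= inord_val.
  rewrite rP => /mapP[j]; rewrite mem_block => /and3P[_ jN /eqP ji] gi.
  by exists (inord j); rewrite inordK.
have [t tP] := choice ex_j.
have t_inj : injective t.
  move=> i j tij; apply/alpha_inj/(fmorph_inj (g : {rmorphism K -> K})) => /=.
  by rewrite !(tP _).1 tij.
rewrite inE (subsetP (galS _ sub1E)) //=.
apply/existsP; exists (perm t_inj); apply/andP; split.
  by apply/block_permsP => i; rewrite permE (tP i).2.
by apply/forallP => i; rewrite permE (tP i).1.
Qed.

Lemma fixed_is_value y : y \in fixedField (gal_of_perms alpha H) ->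
  exists s : seq (invring H * k), y = \sum_(x <- s) ev (val x.1) * x.2%:A.
Proof.
move=> yF.
have gal1 : galois 1 {:K}.
  apply/splitting_galoisField; exists (map_poly (in_alg K) f); split=> //.
    by apply/polyOverP => m; rewrite coef_map /= rpredZ ?mem1v.
  by rewrite separable_map.
have galE : galois <<1 & block_coefs>> {:K}.
  by apply: galoisS gal1; rewrite subv_adjoin_seq subvf.
(* Taking fixed fields reverses the inclusion [gal_block_coefs], and the Galois correspondence
   identifies the larger field with the one generated by [block_coefs]. *)
have yE : y \in <<1 & block_coefs>>%VS.
  have /galois_fixedField <- := galE.
  exact: (subvP (fixedFieldS gal_block_coefs)).
pose P y := exists s : seq (invring H * k),
  y = \sum_(x <- s) ev (val x.1) * x.2%:A.
apply: (@adjoin_seq_subring _ K P block_coefs) yE.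
- split.
  + by exists [:: (1, 1)]; rewrite big_seq1 /= !rmorph1 scale1r mulr1.
  + move=> _ _ [s ->] [t ->]; exists (s ++ [seq (- x.1, x.2) | x <- t]).
    rewrite big_cat big_map /= -sumrN; congr (_ + _).
    by apply: eq_bigr => x _; rewrite !rmorphN mulNr.
  + move=> _ _ [s ->] [t ->]; exists (formal_mul s t).
    rewrite /formal_mul big_allpairs_dep mulr_suml; apply: eq_bigr => x _.
    rewrite mulr_sumr; apply: eq_bigr => z _.
    by rewrite /pair_mul /= -!in_algE !rmorphM mulrACA.
- by move=> b; exists [:: (1, b)]; rewrite big_seq1 /= rmorph1 mul1r.
move=> _ /allpairsP[[l m] [_ _ ->]] /=.
(* The same coefficient with variables in place of roots is invariant, and its value at the roots is
   the given generator. *)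
have cH : (block_poly N beta (@mvar M) 0 l)`_m \in invariant_pred H.
  exact: block_poly_inv.
exists [:: (InvRing cH, 1)]; rewrite big_seq1 /= scale1r mulr1.
rewrite -coef_map rmorph_prod /=; congr (polyseq _)`_m.
by apply: eq_bigr => j _; rewrite map_polyXsubC /= eval_atX.
Qed.

End FixedField.

End Specialization.

Theorem proposition6p2 (k : fieldType) (K : splittingFieldType k) (N : nat)
    (f : {poly k}) (alpha : 'I_N -> K) (phi : {rmorphism symring N -> k})
    (f_monic : f \is monic) (f_size : size f = N.+1)
    (f_sep : separable_poly f) (f_irr : irreducible_poly f)
    (K_split : splittingFieldFor 1%VS (map_poly (in_alg K) f) {:K}%VS)
    (f_roots : map_poly (in_alg K) f = \prod_(i < N) ('X - (alpha i)%:P))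
    (phi_E : forall i : nat, (1 <= i <= N)%N ->
       phi (elemsym N i) = (-1) ^+ i * f`_(N - i))
    (Gal_SN : forall s : 'S_N,
       exists2 g, g \in 'Gal({:K} / 1)%g & permutes_roots alpha g s)
    (a : seq nat) (a_pos : all (fun ai => 0 < ai)%N a) (a_sum : sumn a = N) :
  exists psi : {rmorphism theta_state_space_at a phi ->
                  subvs_of (fixedField (gal_of_perms alpha (young N a)))},
    bijective psi.
Proof.
case: N => [|M] in alpha phi f_size f_roots phi_E Gal_SN a_sum *.
  (* For [N = 0] the polynomial would be constant, hence not irreducible. *)
  by case: f_irr; rewrite f_size.
rewrite /theta_state_space_at /theta_state_space youngE.
set H := block_perms _ _; set F := fixedField _.
have evS := ev_symmetric f_roots phi_E.
have [h hE] := @tensor_lift _ _ _ _ (@symring_incl _ H) phi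
  ((eval_at alpha) \o (val : {rmorphism invring H -> _})) (in_alg K) evS.
have [h' h'E] := @tensor_lift _ _ _ _
  (val : {rmorphism symring M.+1 -> {mpoly int[M.+1]}})
  phi (eval_at alpha) (in_alg K) evS.
have hF t : h t \in F.
  elim/tensor_ind: t => s; rewrite hE; apply: rpred_sum => x _ /=.
  apply: rpredM; last exact: scalar_fixed.
  exact/ev_invariant_fixed/(valP x.1).
have h_inj t : h t = 0 -> t = 0.
  elim/tensor_ind: t => s hs0.
  (* The sum [s] is pushed into Z[x] (x) k, where injectivity is known, and the relation found there
     is pulled back along the retraction, which is the identity on invariants. *)
  have [r [rD rM rH rid]] := mpoly_retraction M (reshape_index a).
  pose ext (s : seq (invring H * k)) : seq ({mpoly int[M.+1]} * k) :=
    [seq (val x.1, x.2) | x <- s].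
  have : tensor_class val phi (ext s) = 0.
    apply: (full_eval_injective f_sep f_roots Gal_SN h'E).
    by rewrite h'E /formal_eval big_map -[RHS]hs0 hE.
  move/tensor_classP => ext0.
  pose rho p : invring H := InvRing (rH p).
  have rhoD : {morph rho : p q / p + q} by move=> p q; apply: val_inj; exact: rD.
  have rhoM (c : symring M.+1) p : rho (val c * p) = symring_incl H c * rho p.
    by apply: val_inj; apply: rM; exact: symring_invariant.
  apply/tensor_classP.
  have := tensor_eq_map rhoD rhoM ext0.
  rewrite -map_comp /= map_id_in // => -[p b] _ /=; congr (_, _).
  by apply: val_inj; apply: rid; exact: valP.
(* The values of [h] lie in [F], so the projection only changes the codomain. *)
pose psi t := vsproj F (h t).
have psiE t : vsval (psi t) = h t by rewrite vsprojK.
have psiB : zmod_morphism psi.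
  by move=> x y; apply: val_inj; rewrite [LHS]psiE [RHS]linearB rmorphB /= !psiE.
have psiM : monoid_morphism psi.
  split=> [|x y]; apply: val_inj; rewrite [LHS]psiE ?rmorph1 //.
  by rewrite [RHS]rmorphM rmorphM /= !psiE.
pose pz := GRing.isZmodMorphism.Build _ _ psi psiB.
pose pm := GRing.isMonoidMorphism.Build _ _ psi psiM.
pose Psi : {rmorphism tensor (@symring_incl _ H) phi -> subvs_of F} :=
  HB.pack psi pz pm.
exists Psi.
have psi_onto y : exists t, psi t = y.
  have [s ys] := fixed_is_value f_sep K_split f_roots (subvsP y).
  by exists (tensor_class _ _ s); apply: val_inj; rewrite /= psiE hE ys.
(* Surjectivity gives a right inverse, and the trivial kernel of [h] makes it two-sided. *)
have [inv invK] := choice psi_onto.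
exists inv => // t; apply/eqP; rewrite -subr_eq0; apply/eqP/h_inj.
by rewrite rmorphB -!psiE invK subrr.
Qed.
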